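(* Let $k\ge 3$ and $a\in\{0,\ldots,k-1\}$ be integers. For every positive integer $n$ divisible by $2k$ there exists a red-blue coloured $k$-graph $H_{k,a}(n)$ on $n$ vertices such that the following hold: (i) $H_{k,a}(n)$ contains a tight Hamilton cycle; (ii) every tight Hamilton cycle $C$ in $H_{k,a}(n)$ satisfies $c(C)=0$; (iii) for fixed $k$ and $a$, as $n\to\infty$ through multiples of $2k$, $$\delta_1\bigl(H_{k,a}(n)\bigr)=\bigl(d_{k,a}+o(1)\bigr)\binom{n}{k-1}.$$
   Context: A $k$-graph is a hypergraph in which every edge is a set of exactly $k$ vertices. A red-blue coloured $k$-graph is a $k$-graph each of whose edges is coloured red or blue. The minimum vertex degree $\delta_1(H)$ is the minimum, over all vertices $v$ of $H$, of the number of edges containing $v$. A tight Hamilton cycle in an $n$-vertex $k$-graph $H$ is a cyclic ordering $v_1,\ldots,v_n$ of all the vertices of $H$ such that $\{v_i,v_{i+1},\ldots,v_{i+k-1}\}\in E(H)$ for every $i$ (subscripts modulo $n$); its edges are these $n$ sets. For an edge $e$ put $c(e)=1$ if $e$ is red and $c(e)=-1$ if $e$ is blue, and for a subgraph $F$ put $c(F)=\sum_{e\in E(F)}c(e)$. For $k\ge 3$ and $a\in\{0,\ldots,k-1\}$, let $X_{k,a}\sim\operatorname{Bin}\left(k-1,\frac{2a+1}{2k}\right)$ be a binomial random variable, with $\mathbb{P}(X_{k,a}=j)=0$ for $j\notin\{0,\ldots,k-1\}$, and define $$d_{k,a}:=1-\max\bigl\{\mathbb{P}\bigl(X_{k,a}\in\{a-1,a+2\}\bigr),\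 \mathbb{P}\bigl(X_{k,a}\in\{a-2,a+1\}\bigr)\bigr\}.$$ *)

(* Defs.v *)
From HB Require Import structures.
From mathcomp Require Import all_boot all_order all_fingroup all_algebra.
From mathcomp Require Import all_classical all_reals all_analysis.

Set Implicit Arguments.
Unset Strict Implicit.
Unset Printing Implicit Defensive.

Import Order.TTheory GRing.Theory Num.Theory.
Import numFieldNormedType.Exports.

Local Open Scope ring_scope.

Record kgraph (k : nat) (V : finType) := KGraph {
  edges : {set {set V}};
  edges_uniform : {in edges, forall e : {set V}, #|e| = k}
}.

(* The blue edges are those of edges :\: red_edges. *)
Record rb_kgraph (k : nat) (V : finType) := RBKGraph {
  rb_graph :> kgraph k V;
  red_edges : {set {set V}};
  red_edges_sub : red_edges \subset edges rb_graph
}.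

Definition degree k (V : finType) (H : kgraph k V) (v : V) : nat :=
  #|[set e in edges H | v \in e]|.

(* No degree exceeds #|edges H|, so as soon as V is nonempty the default value
   of the iterated minimum is immaterial. *)
Definition min_degree k (V : finType) (H : kgraph k V) : nat :=
  \big[minn/#|edges H|]_(v : V) degree H v.

Definition colour k (V : finType) (H : rb_kgraph k V) (e : {set V}) : int :=
  if e \in red_edges H then 1 else -1.

(* c(F) for a subgraph F, which is given by its set of edges. *)
Definition colour_sum k (V : finType) (H : rb_kgraph k V)
    (F : {set {set V}}) : int :=
  \sum_(e in F) colour H e.

(* A cyclic ordering of the vertex set 'I_n is a permutation v, with v i the
   vertex at position i; ordS is the successor modulo n, so the set below is
   {v_i, v_(i+1), ..., v_(i+k-1)} with subscripts modulo n. *)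
Definition tight_window (k n : nat) (v : {perm 'I_n}) (i : 'I_n) : {set 'I_n} :=
  [set v (iter j (@ordS n) i) | j : 'I_k].

Definition tight_cycle_edges (k n : nat) (v : {perm 'I_n}) : {set {set 'I_n}} :=
  [set tight_window k v i | i : 'I_n].

Definition tight_hamilton_cycle k n (H : kgraph k 'I_n) (v : {perm 'I_n}) :
    Prop :=
  forall i : 'I_n, tight_window k v i \in edges H.

(* P(X_(k,a) \in S) for a set S of integers; X_(k,a) has values in nat. *)
Definition prob_X (R : realType) (k a : nat) (S : set int) : R :=
  fine (binomial_prob k.-1 ((2 * a + 1)%:R / (2 * k)%:R : R)
          [set j : nat | S j%:Z]%classic).

Definition d_ (R : realType) (k a : nat) : R :=
  1 - Num.max (prob_X R k a [set a%:Z - 1; a%:Z + 2]%classic)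
              (prob_X R k a [set a%:Z - 2; a%:Z + 1]%classic).

(* Main.v *)
Require Import Defs.
From HB Require Import structures.
From mathcomp Require Import all_boot all_order all_fingroup all_algebra.
From mathcomp Require Import all_classical all_reals all_analysis.
From mathcomp Require Import zify ring.

Set Implicit Arguments.
Unset Strict Implicit.
Unset Printing Implicit Defensive.

Import Order.TTheory GRing.Theory Num.Theory.
Import numFieldNormedType.Exports.

(** Split the vertices into a class [A] of density [(2a+1)/(2k)] and its
    complement, call [#|e :&: A|] the type of a [k]-set [e], and take as edges
    all [k]-sets except those of type [a-1] or [a+2]; an edge is red when its
    type is [a+1].

    Two consecutive windows of a cyclic ordering of the vertices differ by the
    exchange of one vertex, so their types differ by at most [1].  Along a tight
    Hamilton cycle the type can therefore never jump over one of the two missing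
    values: it stays at most [a-2], or in [{a, a+1}], or at least [a+3].  Every
    vertex lies in exactly [k] windows, hence the average type is
    [k * #|A| / n = a + 1/2], which only the middle range allows
    ([cyclic_walk_trapped]), and there it forces the values [a] and [a+1] to be
    taken equally often.  This is [c(C) = 0] ([barrier_cycle_balanced]).

    For a Hamilton cycle to exist, [A] is spread evenly over ['I_n]: it repeats
    with period [2k], and along the natural cyclic order every [k] consecutive
    vertices meet it in [a] or [a+1] points ([card_window_pattern]).

    For the degrees, an edge at [v] is obtained by choosing [i] vertices of
    [A] and [k-1-i] of its complement, away from [v], and its type is [i] plus
    the indicator of [v \in A].  The number of choices divided by ['C(n, k-1)]
    is a hypergeometric weight, which tends to [P(X = i)]
    ([hypergeometric_limit]).  The types [a-1] and [a+2] thus cost a vertex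
    outside [A] the proportion [P(X \in {a-1, a+2})] and a vertex of [A] the
    proportion [P(X \in {a-2, a+1})]; the minimum degree is governed by the
    larger of the two. *)

(** * Periodic vertex classes *)

(** Moving the window by one step replaces [h i] by the equal [h (i + p)]. *)
Lemma sum_periodic_window (p : nat) (h : nat -> nat) (i : nat) :
  (forall x, h (x + p) = h x) -> \sum_(j < p) h (i + j) = \sum_(j < p) h j.
Proof.
move=> hp; elim: i => [|i IH]; first by apply: eq_bigr.
have := @big_ord_recl nat 0 addn p (fun j => h (i + j)).
rewrite big_ord_recr /= hp addn0 IH.
under [X in _ = _ + X]eq_bigr do rewrite /bump /= add1n addnS -addSn.
by move=> E; apply: (@addnI (h i)); rewrite -E addnC.
Qed.

Lemma sum_periods (p m : nat) (h : nat -> nat) :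
  (forall x, h (x + p) = h x) ->
  \sum_(j < p * m) h j = m * \sum_(j < p) h j.
Proof.
move=> hp; elim: m => [|m IH]; first by rewrite muln0 big_ord0.
rewrite mulnS big_split_ord /= mulSn -IH; congr addn.
by apply: eq_bigr => j _; rewrite addnC hp.
Qed.

(** Each block of [k] consecutive integers contributes its first [a] elements,
    and every other block one more.  Both conditions on [x] depend only on its
    residue modulo [2 * k]. *)
Definition patternA (k a x : nat) : bool := (x %% k < a) || (x %% (2 * k) == a).

Lemma patternA_split k a x : a < k ->
  (patternA k a x : nat) = (x %% k < a) + (x %% (2 * k) == a).
Proof.
rewrite /patternA => ak; case: eqP => [xa|_]; last by rewrite orbF addn0.
have -> : x %% k = a by rewrite -(@modn_dvdm (2 * k)) ?dvdn_mull// xa modn_small.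
by rewrite ltnn.
Qed.

Lemma sum_residue_lt k a i : a < k -> \sum_(j < k) ((i + j) %% k < a) = a.
Proof.
move=> ak.
rewrite (@sum_periodic_window k (fun x => (x %% k < a) : nat)); last first.
  by move=> x; rewrite modnDr.
under eq_bigr => j _ do rewrite modn_small ?ltn_ord//.
transitivity (\sum_(j < k | j < a) 1).
  by rewrite [RHS]big_mkcond; apply: eq_bigr => j _; case: ifP.
by rewrite -(big_ord_widen k (fun=> 1)) ?sum1_card ?card_ord; last exact: ltnW.
Qed.

Lemma sum_residue_eq p a : a < p -> \sum_(j < p) (j %% p == a) = 1.
Proof.
move=> ap; rewrite (bigD1 (Ordinal ap)) //= modn_small // eqxx big1 // => j ja.
by rewrite modn_small //; case: eqP => // e; case/eqP: ja; apply: val_inj.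
Qed.

Definition classA (k a n : nat) : {set 'I_n} := [set x : 'I_n | patternA k a x].

Lemma card_classA k a n : a < k -> 2 * k %| n ->
  #|classA k a n| = (2 * a + 1) * (n %/ (2 * k)).
Proof.
move=> ak /dvdnP[m ->]; have k0 : 0 < 2 * k by lia.
rewrite mulnK // -sum1_card.
under eq_bigl do rewrite inE.
rewrite (big_mkcond (fun x : 'I__ => patternA k a x)) /=.
rewrite (mulnC m).
rewrite (@sum_periods (2 * k) m (fun x => if patternA k a x then 1 else 0)); last first.
  by move=> x; rewrite /patternA modnDr [2 * k]mulSn mul1n addnA !modnDr.
have sumA : \sum_(j < 2 * k) (if patternA k a j then 1 else 0) = 2 * a + 1.
  transitivity (\sum_(j < 2 * k) ((j %% k < a) + (j %% (2 * k) == a))).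
    by apply: eq_bigr => j _; rewrite -patternA_split//; case: (patternA _ _ _).
  rewrite big_split /= sum_residue_eq; last lia.
  rewrite mulnC (@sum_periods k 2 (fun x => x %% k < a)); last first.
    by move=> x; rewrite modnDr.
  by rewrite (@sum_residue_lt k a 0).
by rewrite sumA mulnC.
Qed.

(** Among [k] consecutive integers each residue modulo [k] occurs once, which
    gives the [a] points of the first kind; the extra points are [2 * k] apart,
    so that at most one of them is met. *)
Lemma card_window_pattern k a i : a < k ->
  a <= \sum_(j < k) patternA k a (i + j) <= a.+1.
Proof.
move=> ak; under eq_bigr do rewrite patternA_split //.
rewrite big_split /= sum_residue_lt // leq_addr /= -[a.+1]addn1 leq_add2l.
rewrite -[leqRHS](@sum_residue_eq (2 * k) a); last lia.
rewrite -(@sum_periodic_window (2 * k) (fun x => x %% (2 * k) == a) i); last first.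
  by move=> x; rewrite modnDr.
rewrite (@big_ord_widen _ _ _ k (2 * k)
  (fun j => ((i + j) %% (2 * k) == a) : nat)); last lia.
by rewrite big_mkcond /=; apply: leq_sum => j _; case: ifP.
Qed.

(** * Tight cycles and how often they meet a vertex class *)

Lemma val_iter_ordS n (i : 'I_n) j : iter j (@ordS n) i = (i + j) %% n :> nat.
Proof.
elim: j => [|j IH]; first by rewrite addn0 modn_small.
by rewrite iterS /= IH -addn1 modnDml -addnA addn1.
Qed.

Lemma iter_ordS_inj n (i : 'I_n) j j' : j < n -> j' < n ->
  iter j (@ordS n) i = iter j' (@ordS n) i -> j = j'.
Proof.
move=> jn j'n /(congr1 val) /=; rewrite !val_iter_ordS => /eqP.
by rewrite eqn_modDl !modn_small // => /eqP.
Qed.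

Lemma iter_ordS_onto n (i j : 'I_n) : iter (j + n - i) (@ordS n) i = j.
Proof.
apply: val_inj => /=; rewrite val_iter_ordS subnKC; last first.
  by rewrite (leq_trans (ltnW (ltn_ord i))) ?leq_addl.
by rewrite modnDr modn_small.
Qed.

Section Windows.
Variables (k n : nat) (v : {perm 'I_n}).

Lemma window_position_inj (i : 'I_n) : k <= n ->
  injective (fun j : 'I_k => v (iter j (@ordS n) i)).
Proof.
move=> kn j j' /perm_inj e; apply: val_inj.
by apply: (iter_ordS_inj _ _ e); apply: leq_trans kn.
Qed.

Lemma card_tight_window (i : 'I_n) : k <= n -> #|tight_window k v i| = k.
Proof.
by move=> kn; rewrite card_imset ?card_ord //; exact: window_position_inj.
Qed.

Lemma card_window_class (i : 'I_n) (A : {set 'I_n}) : k <= n ->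
  #|tight_window k v i :&: A| = \sum_(j < k) (v (iter j (@ordS n) i) \in A).
Proof.
move=> kn; rewrite -sum1_card; under eq_bigl do rewrite inE.
rewrite big_mkcondr /= big_imset /=; last by move=> x y _ _; exact: window_position_inj.
by apply: eq_bigr => j _; case: ifP.
Qed.

(** Each vertex lies in exactly [k] windows. *)
Lemma sum_window_class (A : {set 'I_n}) : k <= n ->
  \sum_i #|tight_window k v i :&: A| = k * #|A|.
Proof.
move=> kn; under eq_bigr do rewrite card_window_class //.
rewrite exchange_big /=.
suff E j : \sum_i (v (iter j (@ordS n) i) \in A) = #|A|.
  by under eq_bigr do rewrite E; rewrite sum_nat_const card_ord.
have bij_v : bijective (fun i => v (iter j (@ordS n) i)).
  apply: injF_bij => x y /perm_inj; elim: j => //= j IH e.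
  exact/IH/(ordS_inj e).
rewrite -sum1_card [RHS](reindex _ (onW_bij _ bij_v)) /= [RHS]big_mkcond.
by apply: eq_bigr => i _; case: ifP.
Qed.

(** Passing from one window to the next trades [v i] for the vertex [k] places
    further on; written additively to avoid truncated subtraction. *)
Lemma window_class_step (i : 'I_n) (A : {set 'I_n}) : k <= n ->
  #|tight_window k v (ordS i) :&: A| + (v i \in A) =
  #|tight_window k v i :&: A| + (v (iter k (@ordS n) i) \in A).
Proof.
move=> kn; rewrite !card_window_class //.
have := @big_ord_recl nat 0 addn k (fun j => v (iter j (@ordS n) i) \in A).
rewrite big_ord_recr /= => ->; rewrite addnC; congr addn.
by apply: eq_bigr => j _; rewrite /bump /= -iterSr.
Qed.

(** If the windows at [i] and [i'] coincide, each of the two positions is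
    reached from the other in fewer than [k] steps; the two walks together wind
    around a cycle of length at least [2 * k] in fewer than [2 * k] steps, so
    they are trivial.  Hence the colour sum over the set of edges of a tight
    cycle can be taken over positions. *)
Lemma tight_window_inj : 0 < k -> 2 * k <= n -> injective (tight_window k v).
Proof.
move=> k0 kn i i' e.
have mem_self x : v x \in tight_window k v x.
  by apply/imsetP; exists (Ordinal k0).
have /imsetP[j _ /perm_inj ej] : v i \in tight_window k v i' by rewrite -e mem_self.
have /imsetP[j' _ /perm_inj ej'] : v i' \in tight_window k v i by rewrite e mem_self.
have : iter (j' + j) (@ordS n) i' = iter 0 (@ordS n) i' by rewrite iterD -ej -ej'.
have jk := ltn_ord j; have j'k := ltn_ord j'.
move=> /(@iter_ordS_inj n i' (j' + j) 0) j0.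
have {j0} : j' + j = 0 by apply: j0; lia.
by move/eqP; rewrite addn_eq0 => /andP[_ /eqP j0]; rewrite ej j0.
Qed.

End Windows.

Lemma ordS_invariant n (P : pred 'I_n) (i : 'I_n) :
  (forall x, P x -> P (ordS x)) -> P i -> forall j, P j.
Proof.
move=> PS Pi j; rewrite -(iter_ordS_onto i j).
by elim: (j + n - i) => //= m IH; apply: PS.
Qed.

(** A walk with steps of size at most [1] that never takes the values [a-1] and
    [a+2] cannot cross them, so one bad value would put the whole walk on the
    wrong side of its average [a + 1/2]. *)
Lemma cyclic_walk_trapped n a (t : 'I_n -> nat) :
  (forall i, t (ordS i) <= (t i).+1) -> (forall i, t i <= (t (ordS i)).+1) ->
  (forall i, (t i).+1 != a) -> (forall i, t i != a.+2) ->
  2 * \sum_i t i = (2 * a + 1) * n ->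
  forall i, a <= t i <= a.+1.
Proof.
move=> up down low high mean i0.
have n0 : 0 < n by apply: leq_ltn_trans (ltn_ord i0).
apply/andP; split; rewrite leqNgt; apply/negP => bad.
  have all_low : forall j, t j < a.
    apply: (ordS_invariant _ bad) => x /= tx.
    have := low x; have := up x; have := low (ordS x); lia.
  have : \sum_i t i <= \sum_(i < n) a by apply: leq_sum => i _; exact: ltnW.
  rewrite sum_nat_const card_ord; nia.
have all_high : forall j, a.+1 < t j.
  apply: (ordS_invariant _ bad) => x /= tx.
  have := high x; have := down x; have := high (ordS x); lia.
have : \sum_(i < n) a.+2 <= \sum_i t i by apply: leq_sum.
rewrite sum_nat_const card_ord; nia.
Qed.

(** * The degrees *)

(** The bijection behind this count sends a pair of disjoint sets, one inside
    [A] and one outside, both avoiding [v], to their union with [v]. *)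
Lemma card_star_layer (V : finType) (v : V) (A : {set V}) (k i : nat) : i <= k ->
  #|[set e : {set V} | [&& v \in e, #|e| == k.+1 & #|e :&: A :\ v| == i]]| =
  'C(#|A :\ v|, i) * 'C(#|~: A :\ v|, k - i).
Proof.
move=> ik; rewrite -!cards_draws -cardsX.
set D1 := (X in finset.setX X _); set D2 := (X in finset.setX _ X).
pose join (q : {set V} * {set V}) := v |: (q.1 :|: q.2).
have joinK q : q \in finset.setX D1 D2 ->
    (join q :&: A :\ v, join q :&: ~: A :\ v) = q.
  case: q => X Y; rewrite !inE /= => /andP[/andP[XA _] /andP[YA _]].
  move/fintype.subsetP: XA => XA; move/fintype.subsetP: YA => YA.
  congr pair; apply/finset.setP => x; have := XA x; have := YA x; rewrite !inE;
    case: (x == v) (x \in A) (x \in X) (x \in Y) => [] [] [] [] //= H1 H2;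
    by [have := H1 isT|have := H2 isT].
have join_inj : {in finset.setX D1 D2 &, injective join}.
  by move=> q q' /joinK {2}<- /joinK {2}<- ->.
rewrite -(card_in_imset join_inj); apply: eq_card => e; rewrite inE.
have split_card (f : {set V}) : v \in f ->
    #|f| = (#|f :&: A :\ v| + #|f :&: ~: A :\ v|).+1.
  move=> vf; rewrite (cardsD1 v f) vf add1n; congr _.+1.
  by rewrite -(cardsID A (f :\ v)) [_ :\ v :\: A]finset.setDE !finset.setIDAC.
apply/and3P/imsetP => [[ve /eqP ek /eqP ei]|[[X Y] XY ->]].
  exists (e :&: A :\ v, e :&: ~: A :\ v).
    rewrite !inE /= !finset.setSD ?finset.subsetIr // ei eqxx /=.
    by move: ek; rewrite (split_card e ve) ei => -[<-]; rewrite addKn eqxx.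
  apply/finset.setP => x; rewrite /join !inE; case: eqP => [->|_] //=.
  by rewrite -andb_orr orbN andbT.
have vj : v \in join (X, Y) by rewrite !inE eqxx.
have [jX jY] := joinK _ XY.
rewrite (split_card _ vj) jX jY vj.
move: XY; rewrite !inE /= => /andP[/andP[_ /eqP ->] /andP[_ /eqP ->]].
by rewrite subnKC ?eqxx.
Qed.

Lemma card_star (V : finType) (v : V) (A : {set V}) (k : nat) (P : pred nat) :
  #|[set e : {set V} | [&& v \in e, #|e| == k.+1 & P #|e :&: A|]]| =
  \sum_(i < k.+1 | P (i + (v \in A)))
     'C(#|A :\ v|, i) * 'C(#|~: A :\ v|, k - i).
Proof.
have capE (e : {set V}) : v \in e -> #|e :&: A| = #|e :&: A :\ v| + (v \in A).
  by move=> ve; rewrite (cardsD1 v (e :&: A)) inE ve addnC.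
rewrite -sum1_card (partition_big
  (fun e : {set V} => inord #|e :&: A :\ v| : 'I_k.+1)
  (fun i => P (i + (v \in A)))) /=.
  apply: eq_bigr => i Pi; rewrite -card_star_layer; last by rewrite -ltnS.
  rewrite -sum1_card; apply: eq_bigl => e; rewrite !inE.
  case ve : (v \in e) => //=; case: eqP => //= ek.
  have lek : #|e :&: A :\ v| < k.+1.
    rewrite -ek (cardsD1 v e) ve add1n ltnS; apply: subset_leq_card.
    exact/finset.setSD/finset.subsetIl.
  rewrite -val_eqE /= inordK // capE //.
  by case: eqP => [->|]; rewrite ?Pi ?andbF.
move=> e; rewrite inE => /and3P[ve /eqP ek]; rewrite capE // inordK //.
rewrite -ek (cardsD1 v e) ve add1n ltnS; apply: subset_leq_card.
exact/finset.setSD/finset.subsetIl.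
Qed.

(** * The coloured hypergraph *)

(** Written so that [a - 1] stands for no type at all when [a = 0]. *)
Definition edge_type (a j : nat) : bool := (j.+1 != a) && (j != a.+2).

Section Construction.
Variables k a n : nat.

Definition barrier_edges : {set {set 'I_n}} :=
  [set e : {set 'I_n} | (#|e| == k) && edge_type a #|e :&: classA k a n|].

Lemma barrier_edges_uniform : {in barrier_edges, forall e : {set 'I_n}, #|e| = k}.
Proof. by move=> e; rewrite inE => /andP[/eqP]. Qed.

Definition barrier_red : {set {set 'I_n}} :=
  [set e in barrier_edges | #|e :&: classA k a n| == a.+1].

Lemma barrier_red_sub : barrier_red \subset barrier_edges.
Proof. by apply/fintype.subsetP => e; rewrite inE => /andP[]. Qed.

Definition barrier_graph : rb_kgraph k 'I_n :=
  @RBKGraph k 'I_n (KGraph barrier_edges_uniform) barrier_red barrier_red_sub.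

End Construction.

Section CycleProperties.
Variables k a n : nat.
Hypotheses (ak : a < k) (n0 : 0 < n) (kn : 2 * k %| n).

Let le2kn : 2 * k <= n. Proof. exact: dvdn_leq. Qed.
Let lekn : k <= n. Proof. by apply: leq_trans le2kn; lia. Qed.

Lemma barrier_identity_cycle : tight_hamilton_cycle (barrier_graph k a n) 1%g.
Proof.
move=> i; rewrite inE card_tight_window // eqxx card_window_class //=.
(* Position [i + j] is only known modulo [n], but [2 * k] divides [n]. *)
have -> : \sum_(j < k) ((1%g : {perm 'I_n}) (iter j (@ordS n) i) \in classA k a n)
    = \sum_(j < k) patternA k a (i + j).
  apply: eq_bigr => j _; rewrite perm1 inE val_iter_ordS.
  by rewrite /patternA (modn_dvdm _ kn) modn_dvdm // (dvdn_trans _ kn) ?dvdn_mull.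
have /andP[] := card_window_pattern i ak; rewrite /edge_type; lia.
Qed.

(** As all window types are [a] or [a+1], the colour of a window of type [t] is
    [2 * t - (2 * a + 1)], which has average [0]. *)
Lemma barrier_cycle_balanced (v : {perm 'I_n}) :
  tight_hamilton_cycle (barrier_graph k a n) v ->
  colour_sum (barrier_graph k a n) (tight_cycle_edges k v) = 0%R.
Proof.
move=> ham; pose t i := #|tight_window k v i :&: classA k a n|.
have k0 : 0 < k by lia.
have t_type i : edge_type a (t i) by have := ham i; rewrite inE => /andP[].
have mean : 2 * \sum_i t i = (2 * a + 1) * n.
  by rewrite sum_window_class // card_classA // -[in RHS](divnK kn); ring.
have trapped : forall i, a <= t i <= a.+1.
  apply: cyclic_walk_trapped mean => i; have := t_type i; rewrite /edge_type;
    have := window_class_step v i (classA k a n) lekn; rewrite -/(t i) -/(t (ordS i));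
    by case: (v i \in _); case: (v _ \in _); lia.
rewrite /colour_sum /tight_cycle_edges big_imset /=; last first.
  by move=> i j _ _; exact: tight_window_inj.
have colE i : colour (barrier_graph k a n) (tight_window k v i) =
    (2 * Posz (t i) - Posz (2 * a + 1))%R.
  rewrite /colour inE ham -/(t i) /=; have := trapped i; case: eqP; lia.
under eq_bigr do rewrite colE.
rewrite big_split /= -mulr_sumr sumrN sumr_const card_ord -[(_ *+ n)%R]mulr_natr !natz.
have -> : (\sum_(i in 'I_n) Posz (t i))%R = Posz (\sum_i t i).
  by rewrite (big_morph Posz PoszD (erefl (Posz 0))).
have := congr1 Posz mean; rewrite !PoszM; lia.
Qed.

(** Degree of a vertex that is in [A] exactly when [s] holds, provided [2 * k]
    divides [n]; limits are taken of this formula over all [n]. *)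
Definition star_count (s : bool) : nat :=
  let m := (2 * a + 1) * (n %/ (2 * k)) in
  \sum_(i < k | edge_type a (i + s)) 'C(m - s, i) * 'C(n - m - ~~ s, k.-1 - i).

Lemma barrier_degree (v : 'I_n) :
  degree (barrier_graph k a n) v = star_count (v \in classA k a n).
Proof.
set A := classA k a n.
have [k' Ek] : exists k', k = k'.+1 by exists k.-1; lia.
have -> : degree (barrier_graph k a n) v =
  #|[set e : {set 'I_n} | [&& v \in e, #|e| == k'.+1 & edge_type a #|e :&: A|]]|.
  by apply: eq_card => e; rewrite !inE -Ek andbC.
rewrite card_star /star_count Ek /= -Ek -card_classA // -/A.
have -> : #|A :\ v| = #|A| - (v \in A) by rewrite (cardsD1 v A) addKn.
have -> : #|~: A :\ v| = n - #|A| - (v \notin A).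
  have <- : #|~: A| = n - #|A| by rewrite cardsCs finset.setCK card_ord.
  by rewrite (cardsD1 v (~: A)) inE addKn.
by [].
Qed.

Lemma barrier_min_degree :
  min_degree (barrier_graph k a n) = minn (star_count true) (star_count false).
Proof.
have m0 : 0 < n %/ (2 * k) by rewrite divn_gt0 //; lia.
have En : n = n %/ (2 * k) * (2 * k) by rewrite divnK.
have [x xA] : exists x, x \in classA k a n.
  by apply/set0Pn; rewrite -card_gt0 card_classA //; lia.
have [y yA] : exists y, y \in ~: classA k a n.
  apply/set0Pn; rewrite -card_gt0 cardsCs finset.setCK card_ord card_classA // subn_gt0.
  rewrite [ltnRHS]En; nia.
have deg_ge v : minn (star_count true) (star_count false) <=
    degree (barrier_graph k a n) v.
  by rewrite barrier_degree; case: (_ \in _); rewrite ?geq_minl ?geq_minr.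
apply/eqP; rewrite eqn_leq; apply/andP; split.
  have le_deg v : min_degree (barrier_graph k a n) <= degree (barrier_graph k a n) v.
    rewrite /min_degree; have : v \in index_enum 'I_n by rewrite mem_index_enum.
    elim: (index_enum _) => //= u s IH; rewrite in_cons big_cons geq_min.
    by case/predU1P => [->|/IH ->]; rewrite ?leqnn ?orbT.
  rewrite leq_min; have := le_deg x; have := le_deg y; rewrite !barrier_degree xA.
  by move: yA; rewrite inE => /negbTE -> -> ->.
rewrite /min_degree; elim/big_rec: _ => [|v m _ IH]; last by rewrite leq_min deg_ge.
apply: leq_trans (deg_ge x) _; apply: subset_leq_card.
by apply/fintype.subsetP => e; rewrite inE => /andP[].
Qed.

End CycleProperties.

(** * Asymptotics of the degrees *)

Local Open Scope classical_set_scope.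
Local Open Scope ring_scope.

Section Asymptotics.
Variable R : realType.

(** Stronger than [u n / n --> c], but stable under truncated subtraction of a
    constant by a one-line estimate, which the induction on binomial
    coefficients needs. *)
Definition almost_linear (u : nat -> nat) (c : R) : Prop :=
  exists b : R, forall n, `|(u n)%:R - c * n%:R| <= b.

Lemma almost_linear_subn u c i : almost_linear u c ->
  almost_linear (fun n => u n - i)%N c.
Proof.
move=> [b ub]; exists (b + i%:R) => n.
have -> : ((u n - i)%N%:R - c * n%:R : R) =
    ((u n)%:R - c * n%:R) - (minn i (u n))%:R.
  have -> : ((u n)%:R : R) = (u n - i)%N%:R + (minn i (u n))%:R.
    by rewrite -natrD; congr _%:R; lia.
  by ring.
rewrite (le_trans (ler_normB _ _)) // lerD // normr_nat ler_nat geq_minl //.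
Qed.

Lemma almost_linear_id : almost_linear id 1.
Proof. by exists 0 => n; rewrite mul1r subrr normr0. Qed.

Lemma almost_linear_compl u c : (forall n, (u n <= n)%N) ->
  almost_linear u c -> almost_linear (fun n => n - u n)%N (1 - c).
Proof.
move=> un [b ub]; exists b => n; rewrite natrB // -normrN.
suff -> : - (n%:R - (u n)%:R - (1 - c) * n%:R) = (u n)%:R - c * n%:R by [].
by ring.
Qed.

Lemma almost_linear_divn (p q : nat) : (0 < q)%N ->
  almost_linear (fun n => p * (n %/ q))%N (p%:R / q%:R).
Proof.
move=> q0; exists p%:R => n.
have q0' : (q%:R : R) != 0 by rewrite pnatr_eq0 -lt0n.
have -> : (p * (n %/ q))%N%:R - p%:R / q%:R * n%:R =
    - (p%:R * ((n %% q)%N%:R / q%:R)) :> R.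
  by rewrite [in n%:R](divn_eq n q) natrD !natrM; field.
rewrite normrN normrM normr_nat ler_piMr ?ler0n // ger0_norm ?divr_ge0 //.
by rewrite ler_pdivrMr ?ltr0n // mul1r ler_nat ltnW // ltn_mod.
Qed.

Lemma cvg_invn : (fun n => (n%:R^-1 : R)) @ \oo --> (0 : R).
Proof. by rewrite -cvg_shiftS; exact: cvg_harmonic. Qed.

Lemma almost_linear_ratio u c : almost_linear u c ->
  (fun n => (u n)%:R / n%:R : R) @ \oo --> c.
Proof.
move=> [b ub].
have lim0 : (fun n => b * n%:R^-1 : R) @ \oo --> (0 : R).
  by rewrite -(mulr0 b); apply: cvgM; [exact: cvg_cst|exact: cvg_invn].
apply/subr_cvg0/norm_cvg0P.
apply: (squeeze_cvgr _ (@cvg_cst _ (0:R) _ _ _) lim0).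
near=> n; rewrite normr_ge0 /=.
have n0 : (0 < n)%N by near: n; exact: nbhs_infty_gt.
have -> : (u n)%:R / n%:R - c = ((u n)%:R - c * n%:R) / n%:R.
  by field; rewrite pnatr_eq0 -lt0n.
by rewrite normrM normfV normr_nat ler_wpM2r ?invr_ge0 ?ler0n.
Unshelve. all: by end_near.
Qed.

(** Induction on [i], through [(i+1) 'C(u, i+1) = (u - i) 'C(u, i)]. *)
Lemma bin_asymptotics u c i : almost_linear u c ->
  (fun n => 'C(u n, i)%:R / n%:R ^+ i : R) @ \oo --> c ^+ i / i`!%:R.
Proof.
move=> lin; elim: i => [|i IH].
  under eq_fun do rewrite bin0 expr0 divr1.
  by rewrite expr0 divr1; exact: cvg_cst.
have -> : (fun n => 'C(u n, i.+1)%:R / n%:R ^+ i.+1 : R) =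
    (fun n => 'C(u n, i)%:R / n%:R ^+ i * ((u n - i)%N%:R / n%:R) * i.+1%:R^-1).
  apply/funext => n.
  have i0 : (i.+1%:R : R) != 0 by rewrite pnatr_eq0.
  have -> : ('C(u n, i.+1)%:R : R) = 'C(u n, i)%:R * (u n - i)%N%:R / i.+1%:R.
    by apply: (canRL (mulfK i0)); rewrite -!natrM mulnC mul_bin_left mulnC.
  by rewrite exprS invfM; ring.
have -> : c ^+ i.+1 / (i.+1)`!%:R = c ^+ i / i`!%:R * c * i.+1%:R^-1.
  by rewrite factS natrM invfM exprS; ring.
apply: cvgM; last exact: cvg_cst.
by apply: cvgM IH _; exact/almost_linear_ratio/almost_linear_subn.
Qed.

(** Hypergeometric weights converge to binomial ones: each of the three binomial
    coefficients is asymptotic to a power of [n], and the powers cancel. *)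
Lemma hypergeometric_limit u w c d i k : (i <= k)%N ->
  almost_linear u c -> almost_linear w d ->
  (fun n => ('C(u n, i) * 'C(w n, k - i))%N%:R / 'C(n, k)%:R : R) @ \oo -->
  (c ^+ i * d ^+ (k - i) *+ 'C(k, i)).
Proof.
move=> ik lu lw.
have fact0 m : (m`!%:R : R) != 0 by rewrite pnatr_eq0 -lt0n fact_gt0.
have -> : c ^+ i * d ^+ (k - i) *+ 'C(k, i) =
    c ^+ i / i`!%:R * (d ^+ (k - i) / (k - i)`!%:R) * (1 ^+ k / k`!%:R)^-1.
  rewrite expr1n -mulr_natr -(bin_fact ik) !natrM; field.
  by rewrite !fact0 pnatr_eq0 -lt0n bin_gt0.
have nz : 1 ^+ k / k`!%:R != 0 :> R by rewrite expr1n div1r invr_eq0 fact0.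
have lim : (fun n => 'C(u n, i)%:R / n%:R ^+ i *
      ('C(w n, k - i)%:R / n%:R ^+ (k - i)) * ('C(n, k)%:R / n%:R ^+ k)^-1 : R) @ \oo -->
    c ^+ i / i`!%:R * (d ^+ (k - i) / (k - i)`!%:R) * (1 ^+ k / k`!%:R)^-1.
  apply: cvgM; last by apply: cvgV => //; exact: bin_asymptotics almost_linear_id.
  by apply: cvgM; exact: bin_asymptotics.
apply: cvg_trans lim.
(* The two sequences agree only once [n > 0] and ['C(n, k) != 0]. *)
apply: near_eq_cvg; near=> n => /=.
have n0 : (n%:R : R) != 0 by rewrite pnatr_eq0 -lt0n; near: n; exact: nbhs_infty_gt.
have bin0' : ('C(n, k)%:R : R) != 0.
  rewrite pnatr_eq0 -lt0n bin_gt0; near: n; exact: nbhs_infty_ge.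
rewrite natrM -[in n%:R ^+ k](subnKC ik) exprD.
by field; rewrite bin0' !expf_neq0.
Unshelve. all: by end_near.
Qed.

(** The predicate [Q] on [nat] spares the caller the integer set [S], whose
    elements may be negative. *)
Lemma prob_X_compl k a (S : set int) (Q : pred nat) : (0 < k)%N -> (a < k)%N ->
  (forall j : nat, S j%:Z <-> ~~ Q j) ->
  let p : R := (2 * a + 1)%:R / (2 * k)%:R in
  1 - prob_X R k a S =
  \sum_(i < k | Q i) (p ^+ i * (1 - p) ^+ (k.-1 - i) *+ 'C(k.-1, i)).
Proof.
move=> k0 ak SQ p.
have p0 : 0 <= p by rewrite divr_ge0.
have p1 : p <= 1 by rewrite ler_pdivrMr ?ltr0n ?mul1r ?ler_nat; lia.
rewrite /prob_X (binomial_probE _ p1) /=.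
case: k k0 ak @p p0 p1 => // k _ ak p p0 p1 /=.
have total : \sum_(i < k.+1) (p ^+ i * (1 - p) ^+ (k - i) *+ 'C(k, i)) = 1.
  under eq_bigr do rewrite [_ ^+ _ * _]mulrC.
  by rewrite -exprDn subrK expr1n.
rewrite -{1}total (bigID (fun i : 'I__ => Q i)) /=.
rewrite (eq_bigr (fun i : 'I_k.+1 =>
  (if ~~ Q i then p ^+ i * (1 - p) ^+ (k - i) *+ 'C(k, i) else 0)%:E)); last first.
  move=> i _; rewrite diracE.
  case: ifPn => [/SQ Si|nSi]; first by rewrite mem_set // mule1.
  by rewrite memNset ?mule0 // => /= /SQ; apply/negP.
by rewrite sumEFin /= -big_mkcond addrK.
Qed.

End Asymptotics.

Lemma star_count_limit (R : realType) (k a : nat) (s : bool) : (a < k)%N ->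
  let p : R := (2 * a + 1)%:R / (2 * k)%:R in
  (fun n => (star_count k a n s)%:R / 'C(n, k.-1)%:R : R) @ \oo -->
  \sum_(i < k | edge_type a (i + s)) (p ^+ i * (1 - p) ^+ (k.-1 - i) *+ 'C(k.-1, i)).
Proof.
move=> ak p.
pose m n := ((2 * a + 1) * (n %/ (2 * k)))%N.
have m_lin : almost_linear m p by apply: almost_linear_divn; lia.
have m_le n : (m n <= n)%N.
  by rewrite (leq_trans _ (leq_trunc_div n (2 * k))) // mulnC leq_mul //; lia.
under eq_fun do rewrite natr_sum mulr_suml.
apply: cvg_big => [|i _]; first exact: add_continuous.
apply: hypergeometric_limit; first by have := ltn_ord i; lia.
  exact: almost_linear_subn.
exact/almost_linear_subn/almost_linear_compl.
Qed.

Lemma cvg_minr (R : realType) (f g : nat -> R) (b c : R) :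
  f @ \oo --> b -> g @ \oo --> c ->
  (fun n => Num.min (f n) (g n)) @ \oo --> Num.min b c.
Proof.
move=> fb gc; under eq_fun do rewrite minr_absE.
rewrite minr_absE; apply: cvgM; last exact: cvg_cst.
apply: cvgB; first exact: cvgD.
by apply: cvg_norm; exact: cvgB.
Qed.

Theorem theorem1p2 (R : realType) (k a : nat) (hk : (3 <= k)%N) (ha : (a < k)%N) :
  exists H : forall n : nat, rb_kgraph k 'I_n,
    (forall n : nat, (0 < n)%N -> (2 * k %| n)%N ->
       (exists v : {perm 'I_n}, tight_hamilton_cycle (H n) v) /\
       (forall v : {perm 'I_n}, tight_hamilton_cycle (H n) v ->
          colour_sum (H n) (tight_cycle_edges k v) = 0)) /\
    (exists eps : nat -> R,
       eps @ \oo --> (0 : R) /\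
       (forall n : nat, (0 < n)%N -> (2 * k %| n)%N ->
          (min_degree (H n))%:R = (d_ R k a + eps n) * 'C(n, k.-1)%:R)).
Proof.
exists (barrier_graph k a); split=> [n n0 kn|].
  split; first by exists 1%g; exact: barrier_identity_cycle.
  exact: barrier_cycle_balanced.
(* [eps] is defined from the degree formula, which makes sense for every [n];
   the formula gives the minimum degree only when [2 * k] divides [n > 0]. *)
pose ratio s n : R := (star_count k a n s)%:R / 'C(n, k.-1)%:R.
exists (fun n => Num.min (ratio true n) (ratio false n) - d_ R k a); split.
  have k0 : (0 < k)%N by lia.
  have -> : d_ R k a = Num.min
      (1 - prob_X R k a [set a%:Z - 2; a%:Z + 1]%classic)
      (1 - prob_X R k a [set a%:Z - 1; a%:Z + 2]%classic).
    by rewrite -addr_minr -oppr_max maxC.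
  rewrite (@prob_X_compl R k a _ (fun i => edge_type a (i + true))) //; last first.
    move=> j; rewrite /edge_type /=; split=> [[/= e|/= e]|]; lia.
  rewrite (@prob_X_compl R k a _ (fun i => edge_type a (i + false))) //; last first.
    move=> j; rewrite /edge_type /=; split=> [[/= e|/= e]|]; lia.
  apply/subr_cvg0; apply: cvg_minr; exact: star_count_limit.
move=> n n0 kn; rewrite barrier_min_degree // addrC subrK.
have nk : (2 * k <= n)%N by exact: dvdn_leq.
have C0 : 0 < 'C(n, k.-1)%:R :> R by rewrite ltr0n bin_gt0; lia.
rewrite minr_pMl ?ltW // /ratio !divfK ?gt_eqF //.
by rewrite -natr_min.
Qed.
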